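(* Let $\mathcal X$ be a discrete instance space with an unweighted improvement graph having a self-loop at every node, and let $\mathcal Y=\{0,1\}$ with label $1$ preferred to label $0$. Let $A$ be any learner for binary online learning without improvement. Define a learner $A_I$ for online learning with improvement as follows: upon receiving $x^{(t)}$, it implements the hypothesis $h^{(t)}$ with $h^{(t)}(x^{(t)})=A(x^{(t)})$ (the current prediction of $A$ on $x^{(t)}$) and $h^{(t)}(x')=0$ for all $x'\ne x^{(t)}$, and it updates $A$ with the true label of $x^{(t)}$ if a mistake was made. Then the agents never change their features (i.e. $v^{(t)}=x^{(t)}$ for all $t$), and $A_I$ makes a mistake at a round if and only if $A$ makes a mistake at that round.
   Context: Improvement graph: a directed graph $(\mathcal X,E)$; $\Delta(x)=\{v:(x,v)\in E\}$, with $x\in\Delta(x)$. Best response: for $h:\mathcal X\to\{0,1\}$ and $x\in\mathcal X$ let $\Delta_h^+(x)=\{x'\in\Delta(x):h(x')=1\}$, and let $\Delta_h(x)=\Delta_h^+(x)$ if $h(x)=0$ and $\Delta_h^+(x)\neq\emptyset$, and $\Delta_h(x)=\{x\}$ otherwise. Online learning with improvement: at each round $t$, the environment presents $x^{(t)}$; the learner implements $h^{(t)}:\mathcal X\to\{0,1\}$; the agent moves to some $v^{(t)}\in\Delta_{h^{(t)}}(x^{(t)})$ (chosen adversarially); the environment selects $y^{(t)}\in\{0,1\}$; the learner makes a mistake iff $h^{(t)}(v^{(t)})\neq y^{(t)}$, and is told whether it made a mistake. Online learning without improvement: at each round $t$, the learner $A$ receives $x^{(t)}$, predicts $A(x^{(t)})\in\{0,1\}$,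 then the label $y^{(t)}$ is revealed, and $A$ makes a mistake iff $A(x^{(t)})\ne y^{(t)}$; $A$ updates its state only upon mistakes. In the claim, $A$ is run on the same sequence $(x^{(t)},y^{(t)})_t$. *)

(* Defs.v *)
From mathcomp Require Import all_boot.
From mathcomp Require Import boolp classical_sets.

Set Implicit Arguments.
Unset Strict Implicit.
Unset Printing Implicit Defensive.

Local Open Scope classical_set_scope.

(* Labels are booleans: 1 is [true] (the preferred label), 0 is
   [false]. Rounds are numbered from 0. *)

Section ImprovementGraph.
Variables (X : Type) (E : X -> X -> Prop).

Definition nbh (x : X) : set X := [set v | E x v].

Definition pos_nbh (h : X -> bool) (x : X) : set X :=
  [set x' | nbh x x' /\ h x' = true].

Definition best_response (h : X -> bool) (x : X) : set X :=
  if `[< h x = false /\ pos_nbh h x !=set0 >] then pos_nbh h x else [set x].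

End ImprovementGraph.

(* A deterministic learner with an arbitrary memory type; [ol_update s x y] is
   the new memory after the label [y] of [x] is revealed. *)
Record online_learner (X : Type) := OnlineLearner {
  ol_state : Type;
  ol_init : ol_state;
  ol_predict : ol_state -> X -> bool;
  ol_update : ol_state -> X -> bool -> ol_state
}.

Definition updates_only_on_mistakes (X : Type) (A : online_learner X) : Prop :=
  forall (s : ol_state A) (x : X) (y : bool),
    ol_predict s x = y -> ol_update s x y = s.

Section OnlineRun.
Variables (X : Type) (A : online_learner X) (x : nat -> X) (y : nat -> bool).

Fixpoint ol_run (t : nat) : ol_state A :=
  if t is t'.+1 then ol_update (ol_run t') (x t') (y t') else ol_init A.

Definition ol_mistake (t : nat) : bool := ol_predict (ol_run t) (x t) != y t.

End OnlineRun.

(* [il_hypothesis s x] is implemented once [x] has been presented. The last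
   argument of [il_update] tells whether a mistake was made: it is the only
   feedback, neither the new position of the agent nor the label is observed. *)
Record improvement_learner (X : Type) := ImprovementLearner {
  il_state : Type;
  il_init : il_state;
  il_hypothesis : il_state -> X -> X -> bool;
  il_update : il_state -> X -> bool -> il_state
}.

Section ImprovementRun.
Variables (X : Type) (L : improvement_learner X).
Variables (x v : nat -> X) (y : nat -> bool).

Fixpoint il_run (t : nat) : il_state L :=
  if t is t'.+1 then
    let s := il_run t' in
    il_update s (x t') (il_hypothesis s (x t') (v t') != y t')
  else il_init L.

Definition il_implemented (t : nat) : X -> bool :=
  il_hypothesis (il_run t) (x t).

Definition il_mistake (t : nat) : bool := il_implemented t (v t) != y t.

End ImprovementRun.

(* The learner is deterministic, so an adaptive environment amounts to sequences
   x, v, y fixed in advance, of which only v is constrained. *)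
Definition legal_moves (X : Type) (E : X -> X -> Prop)
    (L : improvement_learner X) (x v : nat -> X) (y : nat -> bool) : Prop :=
  forall t : nat, best_response E (il_implemented L x v y t) (x t) (v t).

(* A learner observes only the mistake bit [m]. If the agent stayed at [x], that
   bit determines the label of [x]: this is [true_labelE]. *)
Definition true_label (X : Type) (h : X -> bool) (x : X) (m : bool) : bool :=
  if m then ~~ h x else h x.

Lemma true_labelE (X : Type) (h : X -> bool) (x : X) (y : bool) :
  true_label h x (h x != y) = y.
Proof. by rewrite /true_label; case: (h x); case: y. Qed.

Section Reduction.
Variables (X : eqType) (A : online_learner X).

Definition point_hypothesis (s : ol_state A) (x x' : X) : bool :=
  if x' == x then ol_predict s x else false.

Definition improvement_of : improvement_learner X := {|
  il_state := ol_state A;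
  il_init := ol_init A;
  il_hypothesis := point_hypothesis;
  il_update := fun s x m =>
    if m then ol_update s x (true_label (point_hypothesis s x) x m) else s
|}.

End Reduction.

(* Main.v *)
Require Import Defs.
From mathcomp Require Import all_boot.
From mathcomp Require Import boolp classical_sets.

(* A hypothesis that is positive at most at the agent's own position gives no
   incentive to move.  So the mistake bit reveals the true label, and since [A]
   ignores the rounds without a mistake, both runs are in the same state. *)

Lemma point_hypothesis_self (X : eqType) (A : online_learner X)
    (s : ol_state A) (x : X) : point_hypothesis s x x = ol_predict s x.
Proof. by rewrite /point_hypothesis eqxx. Qed.

Lemma best_response_point_hypothesis (X : eqType) (E : X -> X -> Prop)
    (A : online_learner X) (s : ol_state A) (x : X) :
  best_response E (point_hypothesis s x) x = [set x]%classic.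
Proof.
rewrite /best_response; case: asboolP => // -[hx [x' [_ hx']]].
(* Only [x] can be labelled positive, and [hx] makes it negative, so no improving [x'] exists. *)
have [eq_x'x|ne_x'x] := eqVneq x' x; first by rewrite eq_x'x hx in hx'.
by rewrite /point_hypothesis (negPf ne_x'x) in hx'.
Qed.

Lemma legal_moves_improvement_of (X : eqType) (E : X -> X -> Prop)
    (A : online_learner X) (x v : nat -> X) (y : nat -> bool) :
  legal_moves E (improvement_of A) x v y -> v =1 x.
Proof.
move=> hv t; have := hv t.
by rewrite /il_implemented /= best_response_point_hypothesis.
Qed.

Lemma il_run_improvement_of (X : eqType) (A : online_learner X)
    (hA : updates_only_on_mistakes A) (x v : nat -> X) (y : nat -> bool)
    (vx : v =1 x) (t : nat) :
  il_run (improvement_of A) x v y t = ol_run A x y t.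
Proof.
(* Once [v t] is [x t], the label recovered from the mistake bit is [y t]. *)
elim: t => //= t ->; rewrite vx true_labelE point_hypothesis_self.
(* After a correct prediction the reduction keeps its state, and by [hA] so does [A]. *)
by case: eqP => //= /hA ->.
Qed.

Theorem mainTheorem6 (X : eqType) (E : X -> X -> Prop)
    (self_loops : forall u : X, E u u)
    (A : online_learner X) (hA : updates_only_on_mistakes A)
    (x v : nat -> X) (y : nat -> bool)
    (hv : legal_moves E (improvement_of A) x v y) :
  forall t : nat,
    v t = x t /\
    (il_mistake (improvement_of A) x v y t <-> ol_mistake A x y t).
Proof.
have vx := @legal_moves_improvement_of _ _ _ _ _ _ hv.
move=> t; split; first exact: vx.
(* With equal states and no move, both mistake bits compare the same prediction with [y t]. *)
rewrite /il_mistake /il_implemented il_run_improvement_of //= vx.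
by rewrite point_hypothesis_self.
Qed.
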